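(* Let each $f_i:\mathbb{R}^d\to\mathbb{R}$ be $L_i$-smooth (not necessarily convex), $R=0$, and suppose $f^{\inf}=\inf_{x\in\mathbb{R}^d}f(x)>-\infty$. In EF-BV, suppose $\nu\in(0,1]$, $\lambda\in(0,1]$ is such that $r<1$, and $$0<\gamma\le\frac{1}{L+\tilde L\sqrt{\frac{r_{\mathrm{av}}}{r}}\frac1s}.$$ For every $t\ge1$, let $\hat x^t$ be chosen uniformly at random among $x^0,x^1,\dots,x^{t-1}$. Then $$\mathbb{E}\big[\|\nabla f(\hat x^t)\|^2\big]\le\frac{2\big(f(x^0)-f^{\inf}\big)}{\gamma t}+\frac{G^0}{\theta t},$$ where $G^0=\frac1n\sum_{i=1}^n\|\nabla f_i(x^0)-h_i^0\|^2$.
   Context: $f=\frac1n\sum_{i=1}^nf_i$ with each $f_i$ differentiable with $L_i$-Lipschitz gradient; $\tilde L=\sqrt{\frac1n\sum_iL_i^2}$ and $f$ is $L$-smooth with $L\le\tilde L$. For $\eta\in[0,1)$, $\omega\ge0$, $\mathbb{C}(\eta,\omega)$ is the class of randomized operators $\mathcal{C}:\mathbb{R}^d\to\mathbb{R}^d$ with $\|\mathbb{E}[\mathcal{C}(x)]-x\|\le\eta\|x\|$ and $\mathbb{E}\|\mathcal{C}(x)-\mathbb{E}[\mathcal{C}(x)]\|^2\le\omega\|x\|^2$ for all $x$. Compressors $\mathcal{C}_i^t$ ($i=1,\dots,n$, $t\ge0$) all lie in $\mathbb{C}(\eta,\omega)$; those used at iteration $t$ are independent of all randomness of previous iterations; $\omega_{\mathrm{av}}\in[0,\omega]$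 satisfies, for every $t$ and all $x_1,\dots,x_n$, $\mathbb{E}\|\frac1n\sum_i(\mathcal{C}_i^t(x_i)-\mathbb{E}[\mathcal{C}_i^t(x_i)])\|^2\le\frac{\omega_{\mathrm{av}}}{n}\sum_i\|x_i\|^2$. Algorithm EF-BV (with $R=0$): given $x^0,h_1^0,\dots,h_n^0$, $\gamma>0$, $\lambda,\nu\in(0,1]$, $h^0=\frac1n\sum_ih_i^0$; for $t\ge0$: $d_i^t=\mathcal{C}_i^t(\nabla f_i(x^t)-h_i^t)$, $h_i^{t+1}=h_i^t+\lambda d_i^t$, $d^t=\frac1n\sum_id_i^t$, $h^{t+1}=h^t+\lambda d^t$, $g^{t+1}=h^t+\nu d^t$, $x^{t+1}=x^t-\gamma g^{t+1}$. Constants: $r=(1-\lambda+\lambda\eta)^2+\lambda^2\omega$, $r_{\mathrm{av}}=(1-\nu+\nu\eta)^2+\nu^2\omega_{\mathrm{av}}$, $s=\frac{1}{\sqrt r}-1$, $\theta=s(1+s)\frac{r}{r_{\mathrm{av}}}$ (with $r>0$, $r_{\mathrm{av}}>0$). *)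

(* Defs.v *)
From HB Require Import structures.
From mathcomp Require Import all_boot all_order all_algebra.
From mathcomp Require Import all_classical all_reals all_analysis.
Set Implicit Arguments. Unset Strict Implicit. Unset Printing Implicit Defensive.
Import Order.TTheory GRing.Theory Num.Theory.
Import numFieldNormedType.Exports.
Local Open Scope ring_scope.

Section EFBV.
Variable R : realType.

Definition dotv (d : nat) (u v : 'rV[R]_d) : R := \sum_(j < d) u 0 j * v 0 j.
Definition sqn (d : nat) (u : 'rV[R]_d) : R := \sum_(j < d) u 0 j ^+ 2.
Definition enorm (d : nat) (u : 'rV[R]_d) : R := Num.sqrt (sqn u).

Definition avgv (d n : nat) (v : 'I_n -> 'rV[R]_d) : 'rV[R]_d :=
  n%:R^-1 *: \sum_(i < n) v i.
Definition avgr (n : nat) (v : 'I_n -> R) : R := n%:R^-1 * \sum_(i < n) v i.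

Definition Ltilde (n : nat) (Lc : 'I_n -> R) : R :=
  Num.sqrt (avgr (fun i => Lc i ^+ 2)).

Definition rC (lam eta om : R) : R := (1 - lam + lam * eta) ^+ 2 + lam ^+ 2 * om.
Definition ravC (nu eta omav : R) : R := (1 - nu + nu * eta) ^+ 2 + nu ^+ 2 * omav.
Definition sC (r : R) : R := (Num.sqrt r)^-1 - 1.
Definition thetaC (r rav : R) : R := sC r * (1 + sC r) * (r / rav).

Definition Evec (dT : measure_display) (T : measurableType dT) (mu : probability T R) (d : nat)
  (X : T -> 'rV[R]_d) : 'rV[R]_d :=
  \row_(j < d) fine (\int[mu]_a (X a 0 j)%:E)%E.

Definition upd (T : Type) (s : nat -> T) (k : nat) (a : T) : nat -> T :=
  fun j => if j == k then a else s j.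

(* Iterated expectation over independent seeds a_0 ~ mu 0, ..., a_{t-1} ~ mu (t-1):
   iexp mu t F s = \int[mu 0]_(a_0) ... \int[mu (t-1)]_(a_(t-1)) F (s with a_0..a_(t-1)),
   (the outermost integral being over a_0). *)
Fixpoint iexp (dT : measure_display) (T : measurableType dT) (mu : nat -> probability T R) (t : nat)
  (F : (nat -> T) -> \bar R) (s : nat -> T) : \bar R :=
  match t with
  | 0 => F s
  | k.+1 => iexp mu k (fun s' => (\int[mu k]_a F (upd s' k a))%E) s
  end.

Record efbv_st (d n : nat) := EfbvSt {
  st_x : 'rV[R]_d; st_hi : 'I_n -> 'rV[R]_d; st_h : 'rV[R]_d }.

(* EF-BV with R = 0. C t i a is the compressor C_i^t when the iteration-t seed is a. *)
Fixpoint efbv (T : Type) (d n : nat) (grad : 'I_n -> 'rV[R]_d -> 'rV[R]_d)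
  (C : nat -> 'I_n -> T -> 'rV[R]_d -> 'rV[R]_d)
  (gamma lam nu : R) (x0 : 'rV[R]_d) (h0 : 'I_n -> 'rV[R]_d)
  (s : nat -> T) (t : nat) : efbv_st d n :=
  match t with
  | 0 => EfbvSt x0 h0 (avgv h0)
  | k.+1 =>
      let st := efbv grad C gamma lam nu x0 h0 s k in
      let di := fun i => C k i (s k) (grad i (st_x st) - st_hi st i) in
      let dt := avgv di in
      let g := st_h st + nu *: dt in
      EfbvSt (st_x st - gamma *: g) (fun i => st_hi st i + lam *: di i)
             (st_h st + lam *: dt)
  end.

End EFBV.

(* Main.v *)
Require Import Defs.
From HB Require Import structures.
From mathcomp Require Import all_boot all_order all_algebra ring lra.
From mathcomp Require Import all_classical all_reals all_analysis measurable_realfun.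
Import Order.TTheory GRing.Theory Num.Theory.
Import numFieldNormedType.Exports.
Local Open Scope ring_scope.

Set Implicit Arguments.
Unset Strict Implicit.

(** With [u_i = grad f_i(x) - h_i], [G = avg |u_i|^2] and step direction [g], the descent
    lemma gives
      [f(x+) <= f(x) - gamma/2 |grad f(x)|^2 + gamma/2 |g - grad f(x)|^2
                - gamma/2 (1 - L gamma) |g|^2],
    and Young's inequality with parameter [s] gives
      [G+ <= (1+s) avg |u_i - lam C_i(u_i)|^2 + (1+1/s) Ltilde^2 gamma^2 |g|^2].
    In [V = 2/gamma (f - finf) + G/theta] the step-size condition makes the total
    coefficient of [|g|^2] nonpositive, pathwise.  What remains are two squared
    compression errors, of conditional means at most [rav G] and [r G]; as
    [rav + (1+s) r / theta = 1/theta], this yields [E V+ <= V - |grad f(x)|^2],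
    which telescopes.

    The compressors need not be jointly measurable in the seed and the input, so
    the iterated integrands need not be measurable.  The integral of a
    nonnegative function is in any case a supremum over the simple functions
    below it, hence monotone and superadditive, and this suffices: only
    one-seed integrals at a fixed state have to be computed. *)

(** * Iterated lower integrals *)

Section Integral.
Context (R : realType) (dT : measure_display) (T : measurableType dT).
Implicit Types (mu : {measure set T -> \bar R}) (f g : T -> \bar R).
Local Open Scope ereal_scope.
Import HBNNSimple.

Lemma integral_homo mu f g : (forall x, 0 <= f x) -> (forall x, f x <= g x) ->
  \int[mu]_x f x <= \int[mu]_x g x.
Proof.
move=> f0 fg; have g0 x : 0 <= g x by exact: le_trans (f0 x) (fg x).
rewrite !ge0_integralTE//; apply: ge_ereal_sup => _ [h hf <-].
by apply: ereal_sup_ubound; exists h => // x; exact: le_trans (hf x) (fg x).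
Qed.

(** If simple functions [k] and [h] lie below [f] and [g], then [k + h] is simple and lies below
    [f + g]. The two suprema are taken one after the other; infinite integrals are settled first by
    monotonicity, so that each subtraction is legitimate. *)
Lemma integral_superadditive mu f g :
  (forall x, 0 <= f x) -> (forall x, 0 <= g x) ->
  \int[mu]_x f x + \int[mu]_x g x <= \int[mu]_x (f x + g x).
Proof.
move=> f0 g0; have fg0 x : 0 <= f x + g x by exact: adde_ge0.
have If0 : 0 <= \int[mu]_x f x by exact: integral_ge0.
have [fint|] := boolP (\int[mu]_x f x \is a fin_num); last first.
  rewrite ge0_fin_numE// -leNgt leye_eq => /eqP Ify.
  suff -> : \int[mu]_x (f x + g x) = +oo by exact: leey.
  apply/eqP; rewrite -leye_eq -Ify; apply: integral_homo => // x.
  exact: leeDl.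
rewrite addeC -leeBrDr// {1}ge0_integralTE//.
apply: ge_ereal_sup => _ [h hg <-]; rewrite leeBrDr// addeC.
have hI0 := sintegral_ge0 mu h.
have [hint|] := boolP (sintegral mu h \is a fin_num); last first.
  rewrite ge0_fin_numE// -leNgt leye_eq => /eqP hy.
  suff -> : \int[mu]_x (f x + g x) = +oo by exact: leey.
  apply/eqP; rewrite -leye_eq -hy ge0_integralTE//.
  apply: ereal_sup_ubound; exists h => // x.
  by apply: le_trans (hg x) _; exact: leeDr.
rewrite -leeBrDr// {1}ge0_integralTE//.
apply: ge_ereal_sup => _ [k kf <-]; rewrite leeBrDr// -sintegralD.
rewrite ge0_integralTE//; apply: ereal_sup_ubound.
by exists (add_nnsfun k h) => // x /=; rewrite EFinD; exact: leeD.
Qed.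

End Integral.

Section IteratedExpectation.
Context (R : realType) (dT : measure_display) (T : measurableType dT).
Context (mu : nat -> probability T R).
Implicit Types (F G : (nat -> T) -> \bar R) (s : nat -> T).
Local Open Scope ereal_scope.

Lemma iexp_ge0 t F s : (forall s, 0 <= F s) -> 0 <= iexp mu t F s.
Proof.
by elim: t F => [|t IH] F F0 //=; apply: IH => s'; exact: integral_ge0.
Qed.

Lemma iexp_homo t F G s : (forall s, 0 <= F s) -> (forall s, F s <= G s) ->
  iexp mu t F s <= iexp mu t G s.
Proof.
elim: t F G => [|t IH] F G F0 FG //=; apply: IH => s'; first exact: integral_ge0.
exact: integral_homo.
Qed.

Lemma iexp_superadditive t F G s :
  (forall s, 0 <= F s) -> (forall s, 0 <= G s) ->
  iexp mu t F s + iexp mu t G s <= iexp mu t (fun s => F s + G s) s.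
Proof.
elim: t F G => [|t IH] F G F0 G0 //=.
apply: le_trans (IH _ _ _ _) _; try by move=> s'; exact: integral_ge0.
apply: iexp_homo => s'; first by rewrite adde_ge0 ?integral_ge0.
exact: integral_superadditive.
Qed.

(** The final bound has a sum of expectations on its small side, so superadditivity alone
    suffices. *)
Lemma iexp_sum t m (F : 'I_m -> (nat -> T) -> \bar R) s :
  (forall k s, 0 <= F k s) ->
  \sum_(k < m) iexp mu t (F k) s <= iexp mu t (fun s => \sum_(k < m) F k s) s.
Proof.
elim: m F => [|m IH] F F0.
  by rewrite big_ord0; apply: iexp_ge0 => s'; rewrite big_ord0.
rewrite big_ord_recr/=.
apply: le_trans (leeD (IH _ _) (lexx _)) _ => [k s'|]; first exact: F0.
apply: le_trans (iexp_superadditive _ _ _ _) _ => //.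
- by move=> s'; exact: sume_ge0.
apply: iexp_homo => s'; first by rewrite adde_ge0 ?sume_ge0.
by rewrite big_ord_recr.
Qed.

(** The last seed is integrated innermost, so the one-step bound replaces [V t.+1] by [V t] under
    the remaining integrals. *)
Lemma iexp_supermartingale (V : nat -> (nat -> T) -> \bar R) s :
  (forall t s, 0 <= V t s) ->
  (forall t s, \int[mu t]_a V t.+1 (upd s t a) <= V t s) ->
  forall t, iexp mu t (V t) s <= V 0%N s.
Proof.
move=> V0 Vstep; elim=> [|t IH] //=.
apply: le_trans IH; apply: iexp_homo => s'; last exact: Vstep.
exact: integral_ge0.
Qed.

End IteratedExpectation.
(** * Euclidean norm and averages *)

Section Euclid.
Context (R : realType) (d : nat).
Implicit Types (u v w : 'rV[R]_d) (a b : R).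

Lemma dotvC u v : dotv u v = dotv v u.
Proof. by apply: eq_bigr => j _; rewrite mulrC. Qed.

Lemma dotvDl u v w : dotv (u + v) w = dotv u w + dotv v w.
Proof. by rewrite -big_split; apply: eq_bigr => j _; rewrite mxE mulrDl. Qed.

Lemma dotvZl a u v : dotv (a *: u) v = a * dotv u v.
Proof. by rewrite /dotv big_distrr /=; apply: eq_bigr => j _; rewrite mxE mulrA. Qed.

Lemma dotvDr u v w : dotv u (v + w) = dotv u v + dotv u w.
Proof. by rewrite dotvC dotvDl !(dotvC u). Qed.

Lemma dotvZr a u v : dotv u (a *: v) = a * dotv u v.
Proof. by rewrite dotvC dotvZl dotvC. Qed.

Lemma dotvNl u v : dotv (- u) v = - dotv u v.
Proof. by rewrite -scaleN1r dotvZl mulN1r. Qed.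

Lemma dotvNr u v : dotv u (- v) = - dotv u v.
Proof. by rewrite dotvC dotvNl dotvC. Qed.

Lemma dotv_suml (I : Type) (r : seq I) (F : I -> 'rV[R]_d) v :
  dotv (\sum_(i <- r) F i) v = \sum_(i <- r) dotv (F i) v.
Proof.
elim: r => [|i r IH]; last by rewrite !big_cons dotvDl IH.
by rewrite !big_nil; apply: big1 => j _; rewrite mxE mul0r.
Qed.

Lemma sqnE u : sqn u = dotv u u.
Proof. by apply: eq_bigr => j _; rewrite expr2. Qed.

Definition dotvE := (dotvDl, dotvDr, dotvNl, dotvNr, dotvZl, dotvZr).

Lemma sqn_ge0 u : 0 <= sqn u.
Proof. by apply: sumr_ge0 => j _; exact: sqr_ge0. Qed.

Lemma sqnD u v : sqn (u + v) = sqn u + 2 * dotv u v + sqn v.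
Proof. by rewrite !sqnE !dotvE (dotvC v u); ring. Qed.

Lemma sqnZ a u : sqn (a *: u) = a ^+ 2 * sqn u.
Proof. by rewrite !sqnE !dotvE mulrA expr2. Qed.

Lemma sqnN u : sqn (- u) = sqn u.
Proof. by rewrite !sqnE !dotvE opprK. Qed.

Lemma sqnB u v : sqn (u - v) = sqn u - 2 * dotv u v + sqn v.
Proof. by rewrite sqnD sqnN dotvNr mulrN. Qed.

Lemma enorm_ge0 u : 0 <= enorm u.
Proof. exact: sqrtr_ge0. Qed.

Lemma sqr_enorm u : enorm u ^+ 2 = sqn u.
Proof. by rewrite sqr_sqrtr// sqn_ge0. Qed.

Lemma enormZ a u : 0 <= a -> enorm (a *: u) = a * enorm u.
Proof.
by move=> a0; rewrite /enorm sqnZ sqrtrM ?sqr_ge0// sqrtr_sqr ger0_norm.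
Qed.

Lemma sqn_eq0 u : sqn u = 0 -> u = 0.
Proof.
move/eqP; rewrite psumr_eq0 => [/allP u0|j _]; last exact: sqr_ge0.
apply/rowP => j; rewrite mxE; apply/eqP.
by have := u0 j (mem_index_enum j); rewrite sqrf_eq0.
Qed.

(** Cauchy-Schwarz: expand the square of [enorm v *: u - enorm u *: v] and cancel
    [enorm u * enorm v]; zero norms are treated apart. *)
Lemma dotv_le_enorm u v : dotv u v <= enorm u * enorm v.
Proof.
have [u0|u0] := eqVneq (enorm u) 0.
  have -> : u = 0 by apply: sqn_eq0; rewrite -sqr_enorm u0 expr0n.
  by rewrite -(scale0r u) dotvZl mul0r enormZ// !mul0r.
have [v0|v0] := eqVneq (enorm v) 0.
  have -> : v = 0 by apply: sqn_eq0; rewrite -sqr_enorm v0 expr0n.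
  by rewrite -(scale0r v) dotvZr mul0r enormZ// mul0r mulr0.
have up : 0 < enorm u by rewrite lt_def u0 enorm_ge0.
have vp : 0 < enorm v by rewrite lt_def v0 enorm_ge0.
have := sqn_ge0 (enorm v *: u - enorm u *: v).
rewrite sqnE !dotvE (dotvC v u) -!sqnE -!sqr_enorm => h.
rewrite -(ler_pM2l (mulr_gt0 up vp)); lra.
Qed.

Lemma enormD u v : enorm (u + v) <= enorm u + enorm v.
Proof.
rewrite -(@ler_pXn2r _ 2%N) ?nnegrE ?addr_ge0 ?enorm_ge0//.
rewrite sqr_enorm sqrrD !sqr_enorm sqnE !dotvE (dotvC v u) -!sqnE.
have := dotv_le_enorm u v; lra.
Qed.

Lemma le_sqn a u v : enorm u <= a * enorm v -> sqn u <= a ^+ 2 * sqn v.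
Proof.
move=> uv; rewrite -!sqr_enorm -exprMn.
by rewrite ler_pXn2r ?nnegrE ?enorm_ge0// (le_trans _ uv) ?enorm_ge0.
Qed.

(** The gap between the two sides is [a^-1 * sqn (a *: u - v)]. *)
Lemma sqnD_young a u v : 0 < a ->
  sqn (u + v) <= (1 + a) * sqn u + (1 + a^-1) * sqn v.
Proof.
move=> a0; have := sqn_ge0 (a *: u - v).
rewrite !sqnE !dotvE (dotvC v u) => h.
rewrite -subr_ge0; have -> : (1 + a) * dotv u u + (1 + a^-1) * dotv v v -
  (dotv u u + dotv u v + (dotv u v + dotv v v)) =
  a^-1 * (a * (a * dotv u u) - a * dotv u v - (a * dotv u v - dotv v v)).
  by field; exact: lt0r_neq0.
by apply: mulr_ge0; [rewrite invr_ge0 ltW | lra].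
Qed.

(** Triangle inequality on [(1 - nu) *: u + nu *: (u - e)], both weights being nonnegative. *)
Lemma contraction_bias nu eta u e : 0 <= eta -> 0 < nu <= 1 ->
  enorm (e - u) <= eta * enorm u ->
  sqn (u - nu *: e) <= (1 - nu + nu * eta) ^+ 2 * sqn u.
Proof.
move=> eta0 /andP[nu0 nu1] eu; apply: le_sqn.
have -> : u - nu *: e = (1 - nu) *: u + nu *: (u - e).
  by rewrite scalerBl scale1r scalerBr addrA subrK.
apply: le_trans (enormD _ _) _.
rewrite !enormZ ?subr_ge0 ?(ltW nu0)// [leRHS]mulrDl lerD2l -mulrA ler_pM2l//.
by move: eu; rewrite /enorm -(sqnN (e - u)) opprB.
Qed.

End Euclid.

Section Average.
Context (R : realType) (d n : nat).
Implicit Types (u v : 'I_n -> 'rV[R]_d) (a : R).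

Lemma avgvD u v : avgv (fun i => u i + v i) = avgv u + avgv v.
Proof. by rewrite /avgv big_split scalerDr. Qed.

Lemma avgvZ a u : avgv (fun i => a *: u i) = a *: avgv u.
Proof. by rewrite /avgv -scaler_sumr !scalerA mulrC. Qed.

Lemma avgvB u v : avgv (fun i => u i - v i) = avgv u - avgv v.
Proof. by rewrite /avgv big_split/= sumrN scalerDr scalerN. Qed.

Lemma avgrD (p q : 'I_n -> R) : avgr (fun i => p i + q i) = avgr p + avgr q.
Proof. by rewrite /avgr big_split mulrDr. Qed.

Lemma avgrZ a (p : 'I_n -> R) : avgr (fun i => a * p i) = a * avgr p.
Proof. by rewrite /avgr -big_distrr/= mulrCA. Qed.

Lemma avgr_cst a : (0 < n)%N -> avgr (fun _ : 'I_n => a) = a.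
Proof.
move=> n0; rewrite /avgr big_const_ord iter_addr_0 -[a *+ n]mulr_natl mulKf//.
by rewrite pnatr_eq0 -lt0n.
Qed.

Lemma ler_avgr (p q : 'I_n -> R) : (forall i, p i <= q i) -> avgr p <= avgr q.
Proof. by move=> pq; rewrite ler_wpM2l ?invr_ge0 ?ler0n// ler_sum. Qed.

Lemma avgr_ge0 (p : 'I_n -> R) : (forall i, 0 <= p i) -> 0 <= avgr p.
Proof. by move=> p0; rewrite mulr_ge0 ?invr_ge0 ?ler0n// sumr_ge0. Qed.

Lemma avgv_coord u j : avgv u 0 j = avgr (fun i => u i 0 j).
Proof. by rewrite mxE summxE. Qed.

(** Jensen for the square: the gap is the average of [sqn (u i - avgv u)]. *)
Lemma sqn_avgv u : (0 < n)%N -> sqn (avgv u) <= avgr (fun i => sqn (u i)).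
Proof.
move=> n0; have := @avgr_ge0 (fun i => sqn (u i - avgv u)) (fun i => sqn_ge0 _).
suff -> : avgr (fun i => sqn (u i - avgv u)) = avgr (fun i => sqn (u i)) - sqn (avgv u).
  by rewrite subr_ge0.
rewrite (_ : avgr (fun i => sqn (u i - avgv u)) =
  avgr (fun i => sqn (u i) + (- 2 * dotv (u i) (avgv u) + sqn (avgv u)))); last first.
  congr avgr; apply/funext => i.
  by rewrite sqnB addrA mulNr.
rewrite !avgrD avgrZ.
have -> : avgr (fun i => dotv (u i) (avgv u)) = sqn (avgv u).
  by rewrite /avgr -dotv_suml -dotvZl sqnE.
by rewrite avgr_cst//; ring.
Qed.

End Average.
(** * Means and the bias-variance decomposition *)

Section Mean.
Context (R : realType) (dT : measure_display) (T : measurableType dT).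
Context (mu : probability T R).
Implicit Types (f g : T -> R) (e c : R).

(** Integrability travels with the value, so that linearity applies without further side
    conditions. *)
Definition has_mean f e :=
  mu.-integrable setT (EFin \o f) /\ \int[mu]_a f a = e.

Lemma has_mean_integral f e : has_mean f e -> (\int[mu]_a (f a)%:E = e%:E)%E.
Proof. by case=> fi <-; rewrite fineK// integrable_fin_num. Qed.

Lemma has_mean_cst c : has_mean (cst c) c.
Proof.
split; first exact: finite_measure_integrable_cst.
rewrite Rintegral_cst// -[RHS]mulr1; congr (_ * _).
exact: (congr1 fine (probability_setT mu)).
Qed.

Lemma has_meanD f g e c :
  has_mean f e -> has_mean g c -> has_mean (fun a => f a + g a) (e + c).
Proof.
move=> [fi <-] [gi <-]; split; last by rewrite RintegralD.
exact: (integrableD _ fi gi).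
Qed.

Lemma has_meanZ c f e : has_mean f e -> has_mean (fun a => c * f a) (c * e).
Proof.
move=> [fi <-]; split; last by rewrite RintegralZl.
exact: (integrableZl _ _ fi).
Qed.

Lemma has_mean_sum (I : Type) (r : seq I) (F : I -> T -> R) (e : I -> R) :
  (forall i, has_mean (F i) (e i)) ->
  has_mean (fun a => \sum_(i <- r) F i a) (\sum_(i <- r) e i).
Proof.
move=> Fe; elim: r => [|i r IH].
  rewrite big_nil (_ : (fun _ => _) = cst 0); first exact: has_mean_cst.
  by apply/funext => a; rewrite big_nil.
rewrite big_cons (_ : (fun _ => _) = (fun a => F i a + \sum_(j <- r) F j a)).
  exact: has_meanD.
by apply/funext => a; rewrite big_cons.
Qed.

Lemma has_mean_avgr n (F : 'I_n -> T -> R) (e : 'I_n -> R) :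
  (forall i, has_mean (F i) (e i)) ->
  has_mean (fun a => avgr (fun i => F i a)) (avgr e).
Proof. by move=> Fe; apply: has_meanZ; exact: has_mean_sum. Qed.

Section RandomVector.
Context (d : nat) (X : T -> 'rV[R]_d).
Hypothesis intX : forall j, mu.-integrable setT (fun a => (X a 0 j)%:E).

Lemma has_mean_coord j : has_mean (fun a => X a 0 j) (Evec mu X 0 j).
Proof. by split; [exact: intX | rewrite mxE]. Qed.

Lemma has_mean_centered j : has_mean (fun a => (X a - Evec mu X) 0 j) 0.
Proof.
have := has_meanD (has_mean_coord j) (has_mean_cst (- Evec mu X 0 j)).
rewrite subrr; congr has_mean; apply/funext => a.
by rewrite !mxE.
Qed.

Lemma has_mean_dotv_centered (w : 'rV[R]_d) :
  has_mean (fun a => dotv w (X a - Evec mu X)) 0.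
Proof.
have := has_mean_sum (index_enum 'I_d)
  (fun j => has_meanZ (w 0 j) (has_mean_centered j)).
by rewrite big1// => j _; rewrite mulr0.
Qed.

(** Measurability comes from the coordinates; the finite bound [v] then gives integrability. *)
Lemma has_mean_sqn_centered (v : R) :
  (\int[mu]_a (sqn (X a - Evec mu X))%:E <= v%:E)%E ->
  exists2 e, has_mean (fun a => sqn (X a - Evec mu X)) e & e <= v.
Proof.
move=> iv; have mX : measurable_fun setT (fun a => sqn (X a - Evec mu X)).
  apply: measurable_sum => j; apply: measurable_funX.
  have [/integrableP[+ _] _] := has_mean_centered j.
  by move/measurable_EFinP.
have iX : mu.-integrable setT (EFin \o (fun a => sqn (X a - Evec mu X))).
  apply/integrableP; split; first exact/measurable_EFinP.
  apply: le_lt_trans (ltry v); apply: le_trans iv.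
  by under eq_integral do rewrite /= ger0_norm ?sqn_ge0//.
exists (\int[mu]_a sqn (X a - Evec mu X)) => //.
by rewrite -lee_fin fineK// integrable_fin_num.
Qed.

(** Bias-variance decomposition about [Evec mu X]: the cross term has mean zero, and the variance is
    known only through its bound [v]. *)
Lemma has_mean_sqn_affine (u : 'rV[R]_d) (lam v : R) :
  (\int[mu]_a (sqn (X a - Evec mu X))%:E <= v%:E)%E ->
  exists2 e, has_mean (fun a => sqn (u - lam *: X a)) e &
    e <= sqn (u - lam *: Evec mu X) + lam ^+ 2 * v.
Proof.
move=> /has_mean_sqn_centered[e ee ev]; set m := Evec mu X.
exists (sqn (u - lam *: m) + (- (2 * lam) * 0 + lam ^+ 2 * e)); last first.
  by rewrite mulr0 add0r lerD2l ler_wpM2l ?sqr_ge0.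
have := has_meanD (has_mean_cst (sqn (u - lam *: m)))
  (has_meanD (has_meanZ (- (2 * lam)) (has_mean_dotv_centered (u - lam *: m)))
             (has_meanZ (lam ^+ 2) ee)).
congr has_mean; apply/funext => a /=; rewrite -/m.
have -> : u - lam *: X a = u - lam *: m - lam *: (X a - m).
  by rewrite scalerBr opprB addrA subrK.
by rewrite [RHS]sqnB sqnZ dotvZr; ring.
Qed.

End RandomVector.
End Mean.
(** * Descent along one iteration *)

Section Descent.
Context (R : realType) (d : nat).

(** Both derivatives are limits of the same difference quotients. *)
Lemma is_derive_line (F : 'rV[R]_d -> R^o) (x v : 'rV[R]_d) (t df : R) :
  is_derive (x + t *: v) v F df ->
  is_derive t 1 (fun h : R => F (x + h *: v) : R) df.
Proof.
have E : (fun h : R => h^-1 *: (((fun h : R => F (x + h *: v) : R) \o shift t)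
    (h *: 1) - F (x + t *: v))) =
  (fun h : R => h^-1 *: ((F \o shift (x + t *: v)) (h *: v) - F (x + t *: v))).
  apply/funext => h /=; congr (_ *: (F _ - _)).
  by rewrite scalerDl -[h *: 1]/(h * 1) mulr1 addrCA.
move=> [dF DF]; split; first by rewrite /derivable E.
by rewrite -DF /derive E.
Qed.

(** Mean value theorem on the unit interval for [phi], which is [F] along the segment minus the
    linear and quadratic terms of the bound. Cauchy-Schwarz and the Lipschitz bound make [dphi]
    nonpositive at the intermediate point. *)
Lemma descent_lemma (F : 'rV[R]_d -> R^o) (g : 'rV[R]_d -> 'rV[R]_d) (L : R) :
  (forall x v, is_derive x v F (dotv (g x) v)) ->
  (forall x y, enorm (g x - g y) <= L * enorm (x - y)) ->
  forall x v, F (x + v) <= F x + dotv (g x) v + L / 2 * sqn v.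
Proof.
move=> dF gL x v.
pose phi (h : R) : R := F (x + h *: v) - (dotv (g x) v * h + L / 2 * sqn v * h ^+ 2).
pose dphi (h : R) : R := dotv (g (x + h *: v)) v - (dotv (g x) v + L * sqn v * h).
have phiE h : is_derive h (1 : R) phi (dphi h).
  have := is_derive_line (dF (x + h *: v) v) => ?.
  apply: is_derive_eq.
  by rewrite /GRing.scale /= /dphi; field.
have cphi : {within `[0, 1], continuous phi}%classic.
  apply: continuous_subspaceT => h.
  by apply: differentiable_continuous; apply/derivable1_diffP; case: (phiE h).
have [c c01] := MVT (ltr01 : 0 < 1 :> R) (fun h _ => phiE h) cphi.
rewrite /phi scale0r scale1r addr0 expr0n expr1n !mulr0 !mulr1 addr0 !subr0 => phi01.
suff : dphi c <= 0 by move: phi01; rewrite mulr1; lra.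
have c0 : 0 <= c by move: c01; rewrite in_itv => /andP[/ltW].
have -> : dphi c = dotv (g (x + c *: v) - g x) v - L * c * sqn v.
  by rewrite /dphi dotvDl dotvNl; ring.
rewrite subr_le0; apply: le_trans (dotv_le_enorm _ _) _.
apply: le_trans (ler_wpM2r (enorm_ge0 _) (gL _ _)) _.
by rewrite addrC addKr enormZ// -sqr_enorm expr2 !mulrA.
Qed.

Lemma is_derive_avgr n (F : 'I_n -> 'rV[R]_d -> R^o)
    (g : 'I_n -> 'rV[R]_d -> 'rV[R]_d) :
  (forall i x v, is_derive x v (F i) (dotv (g i x) v)) ->
  forall x v, is_derive x v (fun y => avgr (fun i => F i y) : R^o)
                (dotv (avgv (fun i => g i x)) v).
Proof.
move=> dF x v.
have := is_deriveZ (n%:R^-1) (is_derive_sum (fun i => dF i x v)).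
rewrite (_ : _ \*: _ = (fun y => avgr (fun i => F i y) : R^o)).
  by rewrite /avgv dotvZl dotv_suml.
by apply/funext => y /=; rewrite /avgr fct_sumE.
Qed.

End Descent.

(** * Algebra of the constants *)

Section Constants.
Context (R : realType) (r rav : R).
Hypotheses (r0 : 0 < r) (r1 : r < 1) (rav0 : 0 < rav).

Lemma sC_gt0 : 0 < sC r.
Proof.
have q0 : 0 < Num.sqrt r by rewrite sqrtr_gt0.
by rewrite subr_gt0 invf_gt1// -sqrtr1 ltr_sqrt.
Qed.

Lemma sqr_1DsC : (1 + sC r) ^+ 2 * r = 1.
Proof.
rewrite /sC addrC subrK exprVn sqr_sqrtr ?ltW//.
by rewrite mulVf// gt_eqF.
Qed.

Lemma thetaC_gt0 : 0 < thetaC r rav.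
Proof.
have s0 := sC_gt0.
by rewrite mulr_gt0 ?divr_gt0// mulr_gt0// ltr_wpDl.
Qed.

(** With [s = sC r], the relation [(1 + s) ^+ 2 * r = 1] turns [(thetaC r rav)^-1] into
    [rav * (1 + s^-1)] and [(1 + s) * r] into [(1 + s)^-1]. *)
Lemma lyapunov_weight :
  rav + (thetaC r rav)^-1 * ((1 + sC r) * r) = (thetaC r rav)^-1.
Proof.
have s0 := sC_gt0; have := sqr_1DsC; rewrite /thetaC; move: (sC r) s0 => s s0 h.
have sN0 : s != 0 by rewrite gt_eqF.
have s1N0 : 1 + s != 0 by rewrite gt_eqF// addr_gt0.
have rE : r = ((1 + s) ^+ 2)^-1.
  by apply: (mulfI (expf_neq0 2 s1N0)); rewrite h mulfV// expf_neq0.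
by rewrite rE; field; rewrite lt0r_neq0 ?s1N0.
Qed.

(** The left side is [(gamma * K) ^+ 2] with [K = Lt * Num.sqrt (rav / r) * (sC r)^-1]. As
    [gamma * (L + K) <= 1], it is at most [gamma * K], hence at most [1 - L * gamma]. *)
Lemma step_size_bound (L Lt gamma : R) : 0 <= L -> 0 <= Lt -> 0 < gamma ->
  gamma <= (L + Lt * Num.sqrt (rav / r) * (sC r)^-1)^-1 ->
  (thetaC r rav)^-1 * ((1 + (sC r)^-1) * (Lt ^+ 2 * gamma ^+ 2))
    <= 1 - L * gamma.
Proof.
move=> L0 Lt0 g0; have s0 := sC_gt0.
have s1 : 0 < 1 + sC r by rewrite addr_gt0.
set K := Lt * _ * _ => gLK.
have K0 : 0 <= K by rewrite !mulr_ge0 ?sqrtr_ge0// invr_ge0 ltW.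
(* Since [0^-1 = 0], a positive [gamma] below the inverse excludes [L + K = 0]. *)
have LK0 : 0 < L + K by rewrite -invr_gt0 (lt_le_trans g0).
have gLK1 : gamma * (L + K) <= 1.
  by move: gLK; rewrite -[_^-1]mul1r ler_pdivlMr.
have -> : (thetaC r rav)^-1 * ((1 + (sC r)^-1) * (Lt ^+ 2 * gamma ^+ 2)) =
    (gamma * K) ^+ 2.
  have q2 : Num.sqrt (rav / r) ^+ 2 = rav / r.
    by rewrite sqr_sqrtr// ltW// divr_gt0.
  rewrite /K /thetaC !exprMn q2; field.
  by rewrite !lt0r_neq0.
have gK1 : gamma * K <= 1.
  by apply: le_trans gLK1; rewrite ler_pM2l// lerDr.
have : (gamma * K) ^+ 2 <= gamma * K.
  by rewrite expr2 ler_piMl// mulr_ge0// ltW.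
by move: gLK1; rewrite mulrDr (mulrC gamma L); lra.
Qed.

End Constants.

(** * Pathwise one-step inequality for the Lyapunov function *)

Section EFBVStep.
Context (R : realType) (d n : nat).
Context (F : 'rV[R]_d -> R^o) (grad : 'I_n -> 'rV[R]_d -> 'rV[R]_d).
Context (Lc : 'I_n -> R) (L : R) (gamma lam nu r rav : R).
Local Notation gradF x := (avgv (fun i => grad i x)).
Hypothesis dF : forall x v, is_derive x v F (dotv (gradF x) v).
Hypothesis gradL :
  forall i x y, enorm (grad i x - grad i y) <= Lc i * enorm (x - y).
Hypothesis gradFL : forall x y, enorm (gradF x - gradF y) <= L * enorm (x - y).
Hypotheses (r0 : 0 < r) (r1 : r < 1) (rav0 : 0 < rav) (gamma0 : 0 < gamma).
Hypothesis gammaL :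
  gamma <= (L + Ltilde Lc * Num.sqrt (rav / r) * (sC r)^-1)^-1.
Local Notation s := (sC r).
Local Notation theta := (thetaC r rav).

Definition lyapunov (finf : R) (x : 'rV[R]_d) (hi : 'I_n -> 'rV[R]_d) : R :=
  2 / gamma * (F x - finf) + theta^-1 * avgr (fun i => sqn (grad i x - hi i)).

(* [gradFL] forces [0 <= L] only when [d > 0]; stating the bound with the factor
   [sqn g] covers [d = 0] as well. *)
Lemma step_size_sqn (g : 'rV[R]_d) :
  theta^-1 * ((1 + s^-1) * (Ltilde Lc ^+ 2 * gamma ^+ 2)) * sqn g
    <= (1 - L * gamma) * sqn g.
Proof.
have [->|g0] := eqVneq (sqn g) 0; first by rewrite !mulr0.
apply: ler_wpM2r; first exact: sqn_ge0.
apply: step_size_bound => //; last exact: sqrtr_ge0.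
(* The Lipschitz bound between [g] and 0, with [g] nonzero, yields [0 <= L]. *)
have gp : 0 < enorm g by rewrite sqrtr_gt0 lt_def g0 sqn_ge0.
have := le_trans (enorm_ge0 _) (gradFL g 0).
by rewrite subr0 pmulr_lge0.
Qed.

(** The messages [c] are arbitrary vectors here; randomness enters only when the two error terms of
    the bound are averaged. *)
Lemma lyapunov_step finf (x : 'rV[R]_d) (hi c : 'I_n -> 'rV[R]_d) :
  lyapunov finf (x - gamma *: (avgv hi + nu *: avgv c))
    (fun i => hi i + lam *: c i)
  <= 2 / gamma * (F x - finf) - sqn (gradF x)
     + (sqn (avgv (fun i => grad i x - hi i) - nu *: avgv c)
        + theta^-1 * (1 + s) *
          avgr (fun i => sqn (grad i x - hi i - lam *: c i))).
Proof.
set g := avgv hi + nu *: avgv c; set x' := x - gamma *: g.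
have s0 := sC_gt0 r0 r1; have th0 := thetaC_gt0 r0 r1 rav0.
have -> : avgv (fun i => grad i x - hi i) - nu *: avgv c = gradF x - g.
  by rewrite avgvB -addrA -opprD.
(* The descent lemma scaled by [2 / gamma], its cross term written through [sqn (gradF x - g)] by
   polarization. *)
have desc : 2 / gamma * (F x' - finf) <= 2 / gamma * (F x - finf)
    - sqn (gradF x) + sqn (gradF x - g) - (1 - L * gamma) * sqn g.
  have := descent_lemma dF gradFL x (- (gamma *: g)).
  rewrite dotvNr dotvZr sqnN sqnZ sqnB -/x' => h.
  rewrite -subr_ge0; move: h; rewrite -subr_ge0.
  rewrite -(pmulr_rge0 _ (divr_gt0 (ltr0n R 2) gamma0)).
  congr (0 <= _); field; exact: lt0r_neq0.
(* Young with parameter [s] separates the compression error from the drift [grad i x' - grad i x];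
   averaging [Lc i ^+ 2] gives [Ltilde Lc ^+ 2]. *)
have Gstep : avgr (fun i => sqn (grad i x' - (hi i + lam *: c i))) <=
    (1 + s) * avgr (fun i => sqn (grad i x - hi i - lam *: c i))
    + (1 + s^-1) * (Ltilde Lc ^+ 2 * gamma ^+ 2) * sqn g.
  have -> : (1 + s^-1) * (Ltilde Lc ^+ 2 * gamma ^+ 2) * sqn g =
      (1 + s^-1) * avgr (fun i => gamma ^+ 2 * sqn g * Lc i ^+ 2).
    rewrite avgrZ /Ltilde sqr_sqrtr; first by ring.
    by apply: avgr_ge0 => i; exact: sqr_ge0.
  rewrite -!avgrZ -avgrD; apply: ler_avgr => i.
  have -> : grad i x' - (hi i + lam *: c i) =
      (grad i x - hi i - lam *: c i) + (grad i x' - grad i x).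
    by rewrite opprD [RHS]addrC -!addrA addKr.
  apply: le_trans (sqnD_young _ _ s0) _; rewrite lerD2l.
  apply: ler_wpM2l; first by rewrite addr_ge0// invr_ge0 ltW.
  have := le_sqn (gradL i x' x).
  have -> : x' - x = - (gamma *: g) by rewrite /x' addrAC subrr add0r.
  by rewrite sqnN sqnZ mulrC.
have := ler_wpM2l (ltW (_ : 0 < theta^-1)) Gstep.
rewrite invr_gt0 => /(_ th0); have := step_size_sqn g.
by rewrite /lyapunov; move: desc; lra.
Qed.

End EFBVStep.
(** * Compression errors and trajectories *)

Section Compressors.
Context (R : realType) (dT : measure_display) (T : measurableType dT).
Context (mu : probability T R) (d n : nat).
Context (u : 'I_n -> 'rV[R]_d) (c : 'I_n -> T -> 'rV[R]_d) (eta om omav : R).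
Hypotheses (n0 : (0 < n)%N) (eta0 : 0 <= eta).
Hypothesis intc : forall i j, mu.-integrable setT (fun a => (c i a 0 j)%:E).
Hypothesis biasc : forall i, enorm (Evec mu (c i) - u i) <= eta * enorm (u i).
Hypothesis varc : forall i,
  (\int[mu]_a (sqn (c i a - Evec mu (c i)))%:E <= (om * sqn (u i))%:E)%E.
Hypothesis varavg :
  (\int[mu]_a (sqn (avgv (fun i => c i a - Evec mu (c i))))%:E
     <= (omav / n%:R * \sum_(i < n) sqn (u i))%:E)%E.

Lemma mean_compression_error (lam : R) i : 0 < lam <= 1 ->
  exists2 e, has_mean mu (fun a => sqn (u i - lam *: c i a)) e &
    e <= rC lam eta om * sqn (u i).
Proof.
move=> lam01; have [e ce eE] := has_mean_sqn_affine (intc i) (u i) lam (varc i).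
exists e => //; apply: le_trans eE _.
by rewrite /rC mulrDl -mulrA lerD2r contraction_bias.
Qed.

(** The averaged message is treated as one random vector: Jensen reduces its bias to the individual
    ones, and [varavg] bounds its variance. *)
Lemma mean_avg_compression_error (nu : R) : 0 < nu <= 1 ->
  exists2 e, has_mean mu (fun a => sqn (avgv u - nu *: avgv (fun i => c i a))) e &
    e <= ravC nu eta omav * avgr (fun i => sqn (u i)).
Proof.
move=> nu01; pose X a := avgv (fun i => c i a).
have mX j : has_mean mu (fun a => X a 0 j) (avgv (fun i => Evec mu (c i)) 0 j).
  rewrite avgv_coord (_ : (fun a => _) = (fun a => avgr (fun i => c i a 0 j))).
    by apply: has_mean_avgr => i; apply: has_mean_coord.
  by apply/funext => a; rewrite avgv_coord.
have intX j : mu.-integrable setT (fun a => (X a 0 j)%:E) by have [] := mX j.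
have EX : Evec mu X = avgv (fun i => Evec mu (c i)).
  by apply/rowP => j; rewrite [LHS]mxE; have [] := mX j.
have varX : (\int[mu]_a (sqn (X a - Evec mu X))%:E
    <= (omav * avgr (fun i => sqn (u i)))%:E)%E.
  rewrite /avgr mulrA; apply: le_trans varavg.
  by under eq_integral do rewrite EX -avgvB.
have [e Xe eE] := has_mean_sqn_affine intX (avgv u) nu varX.
exists e => //; apply: le_trans eE _.
rewrite /ravC mulrDl -mulrA lerD2r EX -avgvZ -avgvB.
apply: le_trans (sqn_avgv _ n0) _; rewrite -avgrZ; apply: ler_avgr => i.
exact: contraction_bias.
Qed.

Lemma mean_compression (lam nu k : R) : 0 < lam <= 1 -> 0 < nu <= 1 -> 0 <= k ->
  exists2 e, has_mean mu (fun a => sqn (avgv u - nu *: avgv (fun i => c i a))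
               + k * avgr (fun i => sqn (u i - lam *: c i a))) e &
    e <= (ravC nu eta omav + k * rC lam eta om) * avgr (fun i => sqn (u i)).
Proof.
move=> lam01 nu01 k0; have [e0 me0 e0E] := mean_avg_compression_error nu01.
have /choice[e he] i : exists e,
    has_mean mu (fun a => sqn (u i - lam *: c i a)) e /\
    e <= rC lam eta om * sqn (u i).
  by have [e] := mean_compression_error i lam01; exists e.
exists (e0 + k * avgr e).
  apply: has_meanD => //; apply: has_meanZ; apply: has_mean_avgr => i.
  by have [] := he i.
rewrite mulrDl -mulrA lerD// ler_wpM2l// -avgrZ; apply: ler_avgr => i.
by have [] := he i.
Qed.

End Compressors.

Section Trajectory.
Context (R : realType) (T : Type) (d n : nat).
Context (grad : 'I_n -> 'rV[R]_d -> 'rV[R]_d)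
  (C : nat -> 'I_n -> T -> 'rV[R]_d -> 'rV[R]_d)
  (gamma lam nu : R) (x0 : 'rV[R]_d) (h0 : 'I_n -> 'rV[R]_d).
Local Notation run := (efbv grad C gamma lam nu x0 h0).

(** The state after [k] steps reads only the seeds before index [k], so [k = t] is included. *)
Lemma efbv_upd (s : nat -> T) t a k : (k <= t)%N -> run (upd s t a) k = run s k.
Proof.
elim: k => [//|k IH] kt /=.
by rewrite IH ?(ltnW kt)// /upd ltn_eqF.
Qed.

Lemma efbv_h (s : nat -> T) k : st_h (run s k) = avgv (st_hi (run s k)).
Proof. by elim: k => [//|k IH] /=; rewrite avgvD avgvZ IH. Qed.

End Trajectory.

(** * Summation over the iterations *)

Unset Implicit Arguments.

Theorem theorem3 (R : realType) (d n : nat) (dT : measure_display) (T : measurableType dT)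
  (fi : 'I_n -> 'rV[R]_d -> R^o) (grad : 'I_n -> 'rV[R]_d -> 'rV[R]_d)
  (Lc : 'I_n -> R) (L finf : R)
  (eta om omav : R)
  (mu : nat -> probability T R)
  (C : nat -> 'I_n -> T -> 'rV[R]_d -> 'rV[R]_d)
  (x0 : 'rV[R]_d) (h0 : 'I_n -> 'rV[R]_d) (gamma lam nu : R) :
  (0 < n)%N ->
  (* each f_i is differentiable with gradient grad i, which is L_i-Lipschitz *)
  (forall i x, differentiable (fi i) x) ->
  (forall i x v, 'd (fi i) x v = dotv (grad i x) v) ->
  (forall i x y, enorm (grad i x - grad i y) <= Lc i * enorm (x - y)) ->
  (* f = (1/n) sum f_i is L-smooth (its gradient is (1/n) sum grad_i), L <= \tilde L *)
  (forall x y, enorm (avgv (fun i => grad i x) - avgv (fun i => grad i y))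
                 <= L * enorm (x - y)) ->
  L <= Ltilde Lc ->
  (* f^inf = inf_x f(x) > -oo *)
  (forall x, finf <= avgr (fun i => fi i x)) ->
  (forall m, (forall x, m <= avgr (fun i => fi i x)) -> m <= finf) ->
  (* compressors C_i^t in C(eta, omega); E[C(x)] is well defined *)
  0 <= eta < 1 -> 0 <= om -> 0 <= omav <= om ->
  (forall t i x (j : 'I_d),
      (mu t).-integrable setT (fun a => (C t i a x 0 j)%:E)) ->
  (forall t i x, enorm (Evec (mu t) (fun a => C t i a x) - x) <= eta * enorm x) ->
  (forall t i x,
      (\int[mu t]_a (sqn (C t i a x - Evec (mu t) (fun a => C t i a x)))%:E
        <= (om * sqn x)%:E)%E) ->
  (forall t (xs : 'I_n -> 'rV[R]_d),
      (\int[mu t]_a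
          (sqn (avgv (fun i => C t i a (xs i) - Evec (mu t) (fun b => C t i b (xs i)))))%:E
        <= (omav / n%:R * \sum_(i < n) sqn (xs i))%:E)%E) ->
  (* step sizes *)
  0 < nu <= 1 -> 0 < lam <= 1 ->
  0 < rC lam eta om -> 0 < ravC nu eta omav ->
  rC lam eta om < 1 ->
  0 < gamma ->
  gamma <= (L + Ltilde Lc * Num.sqrt (ravC nu eta omav / rC lam eta om)
                * (sC (rC lam eta om))^-1)^-1 ->
  forall (t : nat), (1 <= t)%N ->
  forall s0 : nat -> T,
  (* E || grad f (hat x^t) ||^2, hat x^t uniform among x^0..x^(t-1) *)
  ((t%:R)^-1%:E *
     \sum_(k < t)
        iexp mu t (fun s => (sqn (avgv (fun i =>
            grad i (st_x (efbv grad C gamma lam nu x0 h0 s k)))))%:E) s0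
   <= (2 * (avgr (fun i => fi i x0) - finf) / (gamma * t%:R)
       + avgr (fun i => sqn (grad i x0 - h0 i))
         / (thetaC (rC lam eta om) (ravC nu eta omav) * t%:R))%:E)%E.
Proof.
move=> n0 dfi gradfi gradL gradFL _ finfP _ /andP[eta0 _] _ _ intC biasC varC.
move=> varavg nu01 lam01 r0 rav0 r1 gamma0 gammaL t t1 s0.
set r := rC lam eta om in r0 r1 gammaL *; set rav := ravC nu eta omav in rav0 gammaL *.
pose F x : R^o := avgr (fun i => fi i x).
have dF x v : is_derive x v F (dotv (avgv (fun i => grad i x)) v).
  apply: is_derive_avgr => i {}x {}v; split; first exact: diff_derivable.
  by rewrite deriveE.
pose run := efbv grad C gamma lam nu x0 h0.
pose gradsq s k := sqn (avgv (fun i => grad i (st_x (run s k)))).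
pose lyap s k := lyapunov F grad gamma r rav finf (st_x (run s k)) (st_hi (run s k)).
have th0 : 0 < thetaC r rav by exact: thetaC_gt0.
have lyap_ge0 s k : 0 <= lyap s k.
  rewrite addr_ge0// mulr_ge0 ?divr_ge0 ?invr_ge0 ?subr_ge0 ?(ltW gamma0) ?(ltW th0)//.
    exact: finfP.
  by apply: avgr_ge0 => i; exact: sqn_ge0.
(* Adding the squared gradients already met to the Lyapunov value gives a supermartingale. *)
pose V k s := (\sum_(j < k) gradsq s j + lyap s k)%:E.
have V0 k s : (0 <= V k s)%E.
  by rewrite lee_fin addr_ge0// sumr_ge0// => j _; exact: sqn_ge0.
have Vstep k s : (\int[mu k]_a V k.+1 (upd s k a) <= V k s)%E.
  set x := st_x (run s k); set hi := st_hi (run s k).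
  pose u i := grad i x - hi i; pose c i a := C k i a (u i).
  pose q := (thetaC r rav)^-1 * (1 + sC r).
  have q0 : 0 <= q.
    by rewrite mulr_ge0 ?invr_ge0 ?(ltW th0)// addr_ge0// ltW// sC_gt0.
  have [e me eE] := mean_compression n0 eta0 (fun i => intC k i (u i))
    (fun i => biasC k i (u i)) (fun i => varC k i (u i)) (varavg k u) lam01 nu01 q0.
  pose b := \sum_(j < k) gradsq s j + 2 / gamma * (F x - finf).
  (* The integrand is bounded pointwise by [b], which is free of seed [k], plus the compression
     errors; the mean of this integrable majorant is exactly [b + e]. *)
  apply: (@le_trans _ _ (b + e)%:E); last first.
    rewrite lee_fin /V /b -addrA lerD2l /lyap /lyapunov -/x -/hi lerD2l.
    by apply: le_trans eE _; rewrite -/r -/rav /q -mulrA lyapunov_weight.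
  rewrite -(has_mean_integral (has_meanD (has_mean_cst _ b) me)).
  apply: integral_homo => a //; rewrite lee_fin big_ord_recr/=.
  have -> : \sum_(j < k) gradsq (upd s k a) j = \sum_(j < k) gradsq s j.
    by apply: eq_bigr => j _; rewrite /gradsq /run efbv_upd// ltnW.
  (* This new summand cancels the negative squared gradient in the one-step inequality. *)
  have -> : gradsq (upd s k a) k = gradsq s k by rewrite /gradsq /run efbv_upd.
  have := lyapunov_step lam nu dF gradL gradFL r0 r1 rav0 gamma0 gammaL finf x hi
    (fun i => c i a).
  rewrite /lyap/= efbv_upd// efbv_h /upd eqxx -/run -/x -/hi => h.
  rewrite /b /gradsq -/x /q; move: h; rewrite /c /u; lra.
have tN0 : t%:R != 0 :> R by rewrite pnatr_eq0 -lt0n.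
have -> : 2 * (avgr (fun i => fi i x0) - finf) / (gamma * t%:R) +
    avgr (fun i => sqn (grad i x0 - h0 i)) / (thetaC r rav * t%:R) =
    t%:R^-1 * lyap s0 0%N.
  by rewrite /lyap /lyapunov/= /F; field; rewrite tN0 !lt0r_neq0.
rewrite EFinM; apply: lee_wpmul2l; first by rewrite lee_fin invr_ge0.
(* At time 0 the sum in [V] is empty, leaving the initial Lyapunov value; at time [t], [V] dominates
   the sum of squared gradients because [lyap] is nonnegative. *)
have := iexp_supermartingale s0 V0 Vstep t; rewrite {2}/V big_ord0 add0r.
apply: le_trans; apply: le_trans (iexp_sum _ _ _ _) _.
  by move=> k s; rewrite lee_fin sqn_ge0.
apply: iexp_homo => s; first by apply: sume_ge0 => k _; rewrite lee_fin sqn_ge0.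
by rewrite sumEFin lee_fin lerDl.
Qed.
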